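(* Let $d$ and $n$ be positive integers. Let $\mathcal{B}_1,\mathcal{B}_2,\dots,\mathcal{B}_{2d}$ be finite families of axis-parallel boxes in $\mathbb{R}^d$, and let $S\subseteq\mathbb{R}^d$ be a discrete set. Suppose that for every choice of $B_i\in\mathcal{B}_i$ for each $i\in[2d]$ we have \[ \Big|\bigcap_{i=1}^{2d}B_i\cap S\Big|\ge n. \] Then there exists an index $l\in[2d]$ such that $\bigcap\mathcal{B}_l$ contains at least $n$ points of $S$, i.e. $\big|\bigcap_{B\in\mathcal{B}_l}B\cap S\big|\ge n$.
   Context: An axis-parallel box in $\mathbb{R}^d$ is a set of the form $[a_1,b_1]\times\cdots\times[a_d,b_d]$ with $a_i\le b_i$ real numbers. $[m]$ denotes $\{1,\dots,m\}$. *)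

(* Defs.v *)
From HB Require Import structures.
From mathcomp Require Import all_boot all_order all_algebra.
From mathcomp Require Import all_classical all_reals all_analysis.

Set Implicit Arguments.
Unset Strict Implicit.
Unset Printing Implicit Defensive.

Import Order.TTheory GRing.Theory Num.Theory.
Import numFieldNormedType.Exports.

Local Open Scope classical_set_scope.
Local Open Scope ring_scope.

Definition box (R : realType) (d : nat) (a b : 'rV[R]_d) : set 'rV[R]_d :=
  [set x | forall i : 'I_d, a ord0 i <= x ord0 i <= b ord0 i].

Definition is_box (R : realType) (d : nat) (A : set 'rV[R]_d) : Prop :=
  exists a b : 'rV[R]_d, (forall i : 'I_d, a ord0 i <= b ord0 i) /\ A = box a b.

(* Discrete in the subspace topology: accumulation points of S outside S are
   not excluded, so closed discrete (locally finite) sets are a special case. *)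
Definition discrete_subset (T : topologicalType) (S : set T) : Prop :=
  S `<=` isolated S.

(* Main.v *)
Require Import Defs.
From mathcomp Require Import all_boot all_order all_algebra.
From mathcomp Require Import all_classical all_reals all_analysis.
Import Order.TTheory GRing.Theory Num.Theory.
Import numFieldNormedType.Exports.
Local Open Scope classical_set_scope.
Local Open Scope card_scope.
Local Open Scope ring_scope.

(** Each intersection of a family is cut out by [2d] axis-parallel half-spaces,
    one per direction, each contributed by a single box of the family.  Going
    through the [2d] directions, discard each time, among the families that
    remain, one whose half-space in that direction is the tightest, and pick
    its box that realizes this half-space.  The family [l] discarded last is
    at most as tight, in every direction, as the family discarded there, so
    the rainbow intersection of the picked boxes lies in the intersection of
    the family [l]. *)

(** Induction on [s]: the maximizer [m] of [f j] over [A] receives [j] and leaves [A]; the [l] found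
    among the remaining indices satisfies [f j l <= f j m]. *)
Lemma greedy_assignment d (T : orderType d) (I : finType) (J : eqType) (j0 : J)
    (f : J -> I -> T) (s : seq J) (A : {set I}) :
    (0 < #|A|)%N -> (size s <= #|A|)%N ->
  exists (t : I -> J) (l : I), l \in A /\
    forall j, j \in s -> exists i, [/\ i \in A, t i = j & (f j l <= f j i)%O].
Proof.
elim: s A => [|j s IHs] A A_gt0 sA.
  by have /card_gt0P[l lA] := A_gt0; exists (fun=> j0), l.
have /card_gt0P[k kA] := A_gt0.
have [m mA m_max] := @arg_maxP _ _ I k (mem A) (f j) kA.
have cardA : #|A| = #|A :\ m|.+1 by rewrite (cardsD1 m) (mA : m \in A).
(* If [m] is the last index, the size bound leaves no direction after [j], and [m] itself serves as
   [l]. *)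
case: (posnP #|A :\ m|) => [A'0|A'_gt0].
  move: sA; rewrite cardA A'0 ltnS leqn0 => /nilP ->.
  exists (fun=> j), m; split=> // j'; rewrite inE => /eqP ->.
  by exists m.
have [|t [l [/setD1P[_ lA] t_l]]] := IHs _ A'_gt0.
  by move: sA; rewrite cardA.
exists (fun i => if i == m then j else t i), l; split=> // j'.
rewrite inE; case/predU1P => [->|/t_l[i [/setD1P[im iA] ti fi]]].
  by exists m; split; rewrite ?eqxx //; exact: m_max.
by exists i; rewrite (negPf im).
Qed.

Lemma finite_set_argmax d (T : orderType d) (U : Type) (f : U -> T)
    (A : set U) : finite_set A -> A !=set0 ->
  exists2 m, A m & forall x, A x -> (f x <= f m)%O.
Proof.
move=> finA [x0 Ax0].
have /finite_seqP[s imE] := finite_image f finA.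
have /(_ s (f x0)) : forall (s : seq T) y, y \in s ->
    exists2 z, z \in s & forall w, w \in s -> (w <= z)%O.
  move=> {s imE}; elim=> // a s IHs y _.
  case: s IHs => [_|b s /(_ b (mem_head _ _))[z zs z_max]].
    by exists a => [|w]; rewrite ?mem_head // inE => /eqP ->.
  exists (Order.max a z).
    by case: leP => _; rewrite ?mem_head // inE zs orbT.
  by move=> w; rewrite inE le_max => /predU1P[->|/z_max ->]; rewrite ?lexx ?orbT.
have sE x : A x -> f x \in s.
  by move=> Ax; have : (f @` A) (f x) by [exists x]; rewrite imE.
case=> [|z zs z_max]; first exact: sE.
have : (f @` A) z by rewrite imE.
by case=> m Am mz; exists m => // x /sE/z_max; rewrite mz.
Qed.

(** The sign turns upper bounds into lower bounds, so that the tightest half-space always has the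
    largest bound. *)
Definition signed_coord {R : realType} {d} (j : bool * 'I_d) (x : 'rV[R]_d) : R :=
  if j.1 then x ord0 j.2 else - x ord0 j.2.

Lemma is_box_halfspaces (R : realType) d (A : set 'rV[R]_d) : is_box A ->
  exists c : bool * 'I_d -> R, A = [set x | forall j, c j <= signed_coord j x].
Proof.
move=> [a [b [_ ->]]].
exists (fun j => if j.1 then a ord0 j.2 else - b ord0 j.2).
apply/seteqP; split=> x /= xab.
  by move=> [[] i]; rewrite /signed_coord /= ?lerN2; have /andP[] := xab i.
move=> i; have := xab (false, i); rewrite /signed_coord /= lerN2 => ->.
by rewrite (xab (true, i)).
Qed.

Theorem theorem1p2 (R : realType) (d n : nat) (hd : (0 < d)%N) (hn : (0 < n)%N)
  (F : 'I_(2 * d) -> set (set 'rV[R]_d)) (S : set 'rV[R]_d)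
  (hfin : forall i : 'I_(2 * d), finite_set (F i))
  (hne : forall i : 'I_(2 * d), F i !=set0)
  (hbox : forall (i : 'I_(2 * d)) (A : set 'rV[R]_d), F i A -> is_box A)
  (hS : discrete_subset S)
  (hF : forall B : 'I_(2 * d) -> set 'rV[R]_d, (forall i : 'I_(2 * d), F i (B i)) ->
     `I_n #<= (\bigcap_(i : 'I_(2 * d)) B i) `&` S) :
  exists l : 'I_(2 * d), `I_n #<= (\bigcap_(A in F l) A) `&` S.
Proof.
have /choice[c cE] : forall A : set 'rV[R]_d, exists c : bool * 'I_d -> R,
    is_box A -> A = [set x | forall j, c j <= signed_coord j x].
  move=> A; have [/is_box_halfspaces[c cA]|nA] := pselect (is_box A).
    by exists c.
  (* Junk value off the boxes, to make [c] total. *)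
  by exists (fun=> 0).
have /choice[M M_max] : forall ji : (bool * 'I_d) * 'I_(2 * d),
    exists m, F ji.2 m /\ forall A, F ji.2 A -> c A ji.1 <= c m ji.1.
  move=> [j i]; have [m Fm mP] :=
    @finite_set_argmax _ _ _ (c ^~ j) _ (hfin i) (hne i).
  by exists m.
(* There are exactly as many directions as families; [(true, Ordinal hd)] is only a default
   direction. *)
have [||t [l [_ t_l]]] := @greedy_assignment _ R _ _ (true, Ordinal hd)
    (fun j i => c (M (j, i)) j) (enum {: bool * 'I_d}) [set: 'I_(2 * d)]%SET.
- by rewrite cardsT card_ord muln_gt0.
- by rewrite -cardE cardsT card_prod card_bool !card_ord.
have FM i : F i (M (t i, i)) by have [] := M_max (t i, i).
exists l; apply: card_le_trans (hF _ FM) _; apply: subset_card_le.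
move=> x [xM Sx]; split=> // A FA.
rewrite (cE A (hbox _ _ FA)) => j /=.
have [|i [_ ti lei]] := t_l j; first by rewrite mem_enum.
(* The chain is [c A j <= c (M (j, l)) j <= c (M (j, i)) j <= signed_coord j x]. *)
have [_ /(_ A FA) /= leA] := M_max (j, l).
apply: le_trans leA (le_trans lei _).
by have := xM i I; rewrite (cE _ (hbox _ _ (FM i))) ti; apply.
Qed.
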